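(* Consider the machine learning portfolio problem $$\text{(MLP)}\qquad \min_{u\in\mathbb{R}^n}\ \tfrac12u^\top\Sigma u+\lambda\|u\|_1\quad\text{s.t.}\quad \mu^\top u=\rho,\quad \mathbf{1}_n^\top u=1,$$ where $\Sigma\in\mathbb{R}^{n\times n}$ is symmetric positive definite, $\lambda\ge0$, $\mu\in\mathbb{R}^n$, $\rho\in\mathbb{R}$, and $\mathbf{1}_n$ is the all-ones vector. Assume that the optimal solution $u^*$ has at least two components $u_i^*$ and $u_j^*$ with $u_i^*\ne0$, $u_j^*\neq0$ and $\mu_i\ne\mu_j$. Then the KKT mapping $$H(w)=\begin{pmatrix}\Sigma u+\lambda\,\partial\|u\|_1+p_1\mu+p_2\mathbf{1}_n\\ \mu^\top u-\rho\\ \mathbf{1}_n^\top u-1\end{pmatrix},\qquad w=(u,p)\in\mathbb{R}^n\times\mathbb{R}^2,\ p=(p_1,p_2),$$ is global strong metric subregular at $w^*=(u^*,p^* )$ for $0$, where $w^*$ is a saddle point of the Lagrangian (i.e. $0\in H(w^* )$).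
   Context: $\partial\|u\|_1$ denotes the convex subdifferential of the $\ell_1$-norm at $u$. Global strong metric subregularity: a set-valued mapping $\mathcal{H}:\mathbf{X}\rightrightarrows\mathbf{Y}$ is global strong metric subregular at $\bar x$ for $\bar y$, where $\bar y\in\mathcal{H}(\bar x)$, if there is $\mathfrak{c}>0$ with $\mathrm{dist}(x,\bar x)\le\mathfrak{c}\,\mathrm{dist}(\bar y,\mathcal{H}(x))$ for all $x\in\mathbf{X}$. *)

(* Defs.v *)
From HB Require Import structures.
From mathcomp Require Import all_boot all_order all_algebra.
From mathcomp Require Import all_classical all_reals ereal.

Set Implicit Arguments.
Unset Strict Implicit.
Unset Printing Implicit Defensive.

Import Order.TTheory GRing.Theory Num.Theory.

Local Open Scope classical_set_scope.
Local Open Scope ring_scope.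

Section Euclidean.
Context {R : realType}.

Definition dotp n (x y : 'cV[R]_n) : R := (x^T *m y) 0 0.

(* The norm that MathComp-Analysis puts on matrices is the sup norm. *)
Definition l2norm n (x : 'cV[R]_n) : R := Num.sqrt (dotp x x).

Definition l1norm n (x : 'cV[R]_n) : R := \sum_(i < n) `|x i 0|.

(* Extended-real valued, so that the distance to the empty set is +oo. *)
Definition set_dist n (y : 'cV[R]_n) (A : set 'cV[R]_n) : \bar R :=
  ereal_inf [set (l2norm (y - z))%:E | z in A].

Definition sym_posdef n (S : 'M[R]_n) : Prop :=
  S^T = S /\ forall x : 'cV[R]_n, x != 0 -> 0 < dotp x (S *m x).

Definition subdifferential n (f : 'cV[R]_n -> R) (u : 'cV[R]_n) :
    set 'cV[R]_n :=
  [set s | forall v, f u + dotp s (v - u) <= f v].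

Definition global_strong_metric_subregular m n
    (H : 'cV[R]_m -> set 'cV[R]_n) (xbar : 'cV[R]_m) (ybar : 'cV[R]_n) : Prop :=
  H xbar ybar /\
  exists2 c : R, 0 < c &
    forall x, ((l2norm (x - xbar))%:E <= c%:E * set_dist ybar (H x))%E.

End Euclidean.

Section MLP.
Context {R : realType} (n : nat).
Variables (Sigma : 'M[R]_n) (lambda : R) (mu : 'cV[R]_n) (rho : R).

Definition ones : 'cV[R]_n := const_mx 1.

Definition mlp_objective (u : 'cV[R]_n) : R :=
  2^-1 * dotp u (Sigma *m u) + lambda * l1norm u.

Definition mlp_feasible : set 'cV[R]_n :=
  [set u | dotp mu u = rho /\ dotp ones u = 1].

Definition mlp_optimal (u : 'cV[R]_n) : Prop :=
  mlp_feasible u /\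
  forall v, mlp_feasible v -> mlp_objective u <= mlp_objective v.

(* The multipliers p_1 and p_2 are the entries [p 0 0] and [p 1 0]. *)
Definition mlp_lagrangian (u : 'cV[R]_n) (p : 'cV[R]_2) : R :=
  mlp_objective u + p 0 0 * (dotp mu u - rho) + p 1 0 * (dotp ones u - 1).

Definition mlp_saddle_point (u : 'cV[R]_n) (p : 'cV[R]_2) : Prop :=
  (forall q, mlp_lagrangian u q <= mlp_lagrangian u p) /\
  (forall v, mlp_lagrangian u p <= mlp_lagrangian v p).

(* R^n x R^2 is encoded as R^(n + 2), a pair (u, p) being [col_mx u p], so that
   [l2norm] is the Euclidean norm of the product space. *)
Definition mlp_kkt (w : 'cV[R]_(n + 2)) : set 'cV[R]_(n + 2) :=
  let u : 'cV[R]_n := usubmx w in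
  let p : 'cV[R]_2 := dsubmx w in
  [set col_mx (Sigma *m u + lambda *: s + p 0 0 *: mu + p 1 0 *: ones)
              (col_mx (dotp mu u - rho)%:M (dotp ones u - 1)%:M : 'cV[R]_(1 + 1))
  | s in subdifferential (@l1norm R n) u].

End MLP.

(* Main.v *)
Require Import Defs.
From mathcomp Require Import all_boot all_order all_algebra.
From mathcomp Require Import all_classical all_reals ereal.
From mathcomp Require Import ring lra.

(** Let [e = u - u*], [d = p - p*] and let [y] be a point of [H w].  Pairing the
    difference of the stationarity equations with [e], and using the monotonicity
    of the subdifferential, gives [e' Sigma e <= |e| |y| + |d| |y|].  Where
    [u*_i != 0], the i-th subgradient entry satisfies
    [|s_i - s*_i| |u*_i| <= 2 |e_i|]: it is unchanged unless [u_i] loses the sign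
    of [u*_i], and then [|e_i| >= |u*_i|].  So rows i and j of the stationarity
    equation form a 2x2 system, invertible since [mu_i != mu_j], which bounds [d]
    by a multiple of [|e| + |y|] globally.  Both estimates together bound [e],
    hence [w - w*], by a multiple of [|y|]. *)

Import Order.TTheory GRing.Theory Num.Theory.

Local Open Scope ring_scope.

(** * Euclidean and [S]-weighted inner products, Cauchy-Schwarz, coercivity *)

Section DotProduct.
Context {R : realType} {n : nat}.
Implicit Types (x y z : 'cV[R]_n) (S : 'M[R]_n).

Lemma dotpE x y : dotp x y = \sum_i x i 0 * y i 0.
Proof. by rewrite /dotp mxE; apply: eq_bigr => i _; rewrite mxE. Qed.

Lemma dotpC x y : dotp x y = dotp y x.
Proof. by rewrite !dotpE; apply: eq_bigr => i _; rewrite mulrC. Qed.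

Lemma dotpDr x y z : dotp x (y + z) = dotp x y + dotp x z.
Proof. by rewrite /dotp mulmxDr mxE. Qed.

Lemma dotpZr a x y : dotp x (a *: y) = a * dotp x y.
Proof. by rewrite /dotp -scalemxAr mxE. Qed.

Lemma dotpNr x y : dotp x (- y) = - dotp x y.
Proof. by rewrite -scaleN1r dotpZr mulN1r. Qed.

Lemma dotpDl x y z : dotp (x + y) z = dotp x z + dotp y z.
Proof. by rewrite dotpC dotpDr !(dotpC z). Qed.

Lemma dotpZl a x y : dotp (a *: x) y = a * dotp x y.
Proof. by rewrite dotpC dotpZr (dotpC y). Qed.

Lemma dotpNl x y : dotp (- x) y = - dotp x y.
Proof. by rewrite dotpC dotpNr (dotpC y). Qed.

Lemma dotp_deltal i x : dotp (delta_mx i 0) x = x i 0.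
Proof.
rewrite dotpE (bigD1 i) //= mxE !eqxx mul1r big1 ?addr0 // => j ji.
by rewrite mxE (negPf ji) mul0r.
Qed.

Lemma dotp_mulmx_sym S x y : S^T = S -> dotp x (S *m y) = dotp y (S *m x).
Proof. by move=> SE; rewrite dotpC /dotp trmx_mul SE mulmxA. Qed.

Lemma dotp_ge0 x : 0 <= dotp x x.
Proof. by rewrite dotpE sumr_ge0 // => i _; rewrite -expr2 sqr_ge0. Qed.

Lemma dotp_eq0 x : dotp x x = 0 -> x = 0.
Proof.
rewrite dotpE => /eqP; rewrite psumr_eq0; last first.
  by move=> i _; rewrite -expr2 sqr_ge0.
move=> /allP h; apply/matrixP => i j; rewrite (ord1 j) mxE.
by have := h i (mem_index_enum i); rewrite /= mulf_eq0 orbb => /eqP.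
Qed.

Lemma sym_posdef1 : sym_posdef (1%:M : 'M[R]_n).
Proof.
split=> [|x x0]; first exact: trmx1.
rewrite mul1mx lt_def dotp_ge0 andbT.
by apply: contraNneq x0 => /dotp_eq0 ->.
Qed.

Lemma posdef_cauchy_schwarz S x y : sym_posdef S ->
  dotp x (S *m y) ^+ 2 <= dotp x (S *m x) * dotp y (S *m y).
Proof.
move=> [SE Spos]; have [->|y0] := eqVneq y 0.
  by rewrite mulmx0 /dotp !mulmx0 mxE mulr0 expr0n.
have By := Spos _ y0.
set A := dotp x (S *m x); set B := dotp y (S *m y); set C := dotp x (S *m y).
(* Up to the factor [B], this vector is the component of [x] that is [S]-orthogonal to [y]. *)
have: 0 <= dotp (B *: x - C *: y) (S *m (B *: x - C *: y)).
  have [->|z0] := eqVneq (B *: x - C *: y) 0; last exact/ltW/Spos.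
  by rewrite mulmx0 /dotp mulmx0 mxE.
have -> : dotp (B *: x - C *: y) (S *m (B *: x - C *: y)) =
          B * (A * B - C ^+ 2).
  rewrite mulmxBr -!scalemxAr dotpDl !dotpDr !dotpNl !dotpNr !dotpZl !dotpZr.
  rewrite (dotp_mulmx_sym S y x SE) -/A -/B -/C; ring.
by rewrite pmulr_rge0 // subr_ge0.
Qed.

Lemma l2norm_ge0 x : 0 <= l2norm x. Proof. exact: sqrtr_ge0. Qed.

Lemma sqr_l2norm x : l2norm x ^+ 2 = dotp x x.
Proof. by rewrite sqr_sqrtr // dotp_ge0. Qed.

Lemma l2normN x : l2norm (- x) = l2norm x.
Proof. by rewrite /l2norm dotpNl dotpNr opprK. Qed.

Lemma cauchy_schwarz x y : `|dotp x y| <= l2norm x * l2norm y.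
Proof.
rewrite -ler_sqr ?nnegrE ?mulr_ge0 ?l2norm_ge0 // exprMn !sqr_l2norm.
rewrite real_normK ?num_real //.
by have := posdef_cauchy_schwarz _ x y sym_posdef1; rewrite !mul1mx.
Qed.

Lemma coord_le_l2norm x i : `|x i 0| <= l2norm x.
Proof.
rewrite -ler_sqr ?nnegrE ?l2norm_ge0 // sqr_l2norm real_normK ?num_real //.
rewrite dotpE (bigD1 i) //= -expr2 lerDl sumr_ge0 // => j _.
by rewrite -expr2 sqr_ge0.
Qed.

Lemma mulmx_coord_bound S x i :
  `|(S *m x) i 0| <= l2norm (row i S)^T * l2norm x.
Proof.
apply: le_trans (cauchy_schwarz _ _).
by rewrite /dotp trmxK -row_mul [in X in _ <= X]mxE.
Qed.

(** By symmetry a nonzero row of the left kernel, transposed, is a nonzero vector killed by [S], on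
    which the form would vanish. *)
Lemma posdef_unitmx S : sym_posdef S -> S \in unitmx.
Proof.
move=> [SE Spos]; rewrite -row_free_unit -kermx_eq0; apply/eqP/row_matrixP => i.
rewrite row0; apply/eqP; apply: contraT => r0.
have rS : row i (kermx S) *m S = 0 by rewrite -row_mul mulmx_ker row0.
have Sr : S *m (row i (kermx S))^T = 0.
  by apply: trmx_inj; rewrite trmx_mul trmxK SE rS trmx0.
have := Spos (row i (kermx S))^T; rewrite Sr /dotp mulmx0 mxE ltxx; apply.
by apply: contraNneq r0 => /(congr1 trmx); rewrite trmxK trmx0 => ->.
Qed.

(* [x i 0] is the S-inner product of [x] with the i-th column of [S^-1], so
   Cauchy-Schwarz gives the constant tr(S^-1), without compactness or spectra. *)
Lemma posdef_coercive S : sym_posdef S ->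
  exists2 T : R, 0 <= T & forall x, l2norm x ^+ 2 <= T * dotp x (S *m x).
Proof.
move=> Spd; have Su := posdef_unitmx _ Spd.
pose v i : 'cV[R]_n := invmx S *m delta_mx i 0.
have Sge0 z : 0 <= dotp z (S *m z).
  have [->|z0] := eqVneq z 0; last exact/ltW/Spd.2.
  by rewrite mulmx0 /dotp mulmx0 mxE.
exists (\sum_i dotp (v i) (S *m v i)); first exact: sumr_ge0.
move=> x; rewrite sqr_l2norm dotpE mulr_suml; apply: ler_sum => i _.
have := posdef_cauchy_schwarz _ (v i) x Spd.
rewrite dotp_mulmx_sym ?Spd.1 // {1}/v mulKVmx // dotpC dotp_deltal expr2.
by [].
Qed.

End DotProduct.

Lemma sqr_l2norm_col_mx (R : realType) (m n : nat) (x : 'cV[R]_m) (y : 'cV[R]_n) :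
  l2norm (col_mx x y) ^+ 2 = l2norm x ^+ 2 + l2norm y ^+ 2.
Proof. by rewrite !sqr_l2norm /dotp tr_col_mx mul_row_col mxE. Qed.

Lemma l2norm_cV2_le (R : realType) (x : 'cV[R]_2) :
  l2norm x <= `|x 0 0| + `|x 1 0|.
Proof.
rewrite -ler_sqr ?nnegrE ?l2norm_ge0 ?addr_ge0 // sqr_l2norm dotpE.
rewrite !big_ord_recl big_ord0 addr0.
have -> : lift ord0 ord0 = 1 :> 'I_2 by apply/val_inj.
have := normr_ge0 (x 0 0); have := normr_ge0 (x 1 0).
have := real_normK (num_real (x 0 0)); have := real_normK (num_real (x 1 0)).
nra.
Qed.

(** * Subgradients of the l1 norm, coordinate by coordinate *)

Section L1Subdifferential.
Context {R : realType} {n : nat}.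
Implicit Types u v s : 'cV[R]_n.

(** Moving [u] along the i-th axis cancels all other coordinates, so [s i 0] is a subgradient of the
    absolute value at [u i 0]. *)
Lemma subdifferential_l1normP u s i : subdifferential (@l1norm R n) u s ->
  forall t, `|u i 0| + s i 0 * t <= `|u i 0 + t|.
Proof.
move=> su t; have := su (u + t *: delta_mx i 0).
rewrite addrAC subrr add0r dotpZr dotpC dotp_deltal /l1norm.
rewrite (bigD1 i) //= [X in _ <= X](bigD1 i) //= !mxE !eqxx mulr1.
rewrite [X in _ <= _ + X](eq_bigr (fun j => `|u j 0|)); last first.
  by move=> j ji; rewrite !mxE (negPf ji) mulr0 addr0.
by rewrite mulrC; lra.
Qed.

Lemma subdifferential_l1norm_sgr u :
  subdifferential (@l1norm R n) u (map_mx Num.sg u).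
Proof.
move=> v; rewrite /l1norm dotpE -big_split; apply: ler_sum => i _ /=.
rewrite !mxE mulrBr -normrEsg addrC subrK.
apply: le_trans (ler_norm _) _; rewrite normrM normr_sg.
by case: (u i 0 != 0); rewrite ?mul1r ?mul0r.
Qed.

Lemma subdifferential_l1norm_monotone u v s t :
  subdifferential (@l1norm R n) u s -> subdifferential (@l1norm R n) v t ->
  0 <= dotp (u - v) (s - t).
Proof.
move=> /(_ v) su /(_ u) tv; move: su tv.
rewrite (dotpC s) (dotpC t) !dotpDl !dotpDr !dotpNl !dotpNr.
by lra.
Qed.

(* A scalar subgradient [b] at [y] has [|b| <= 1] and [b * y = |y|], so
   [|s_i - t_i| |v_i| = |v_i| - s_i v_i <= |v_i| - |u_i| + |u_i - v_i|]. *)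
Lemma subdifferential_l1norm_coord_lip u v s t i :
  subdifferential (@l1norm R n) u s -> subdifferential (@l1norm R n) v t ->
  `|s i 0 - t i 0| * `|v i 0| <= 2 * `|u i 0 - v i 0|.
Proof.
move=> su tv.
have hs := subdifferential_l1normP _ _ i su.
have ht := subdifferential_l1normP _ _ i tv.
move: (s i 0) (t i 0) (u i 0) (v i 0) hs ht => a b x y hs ht.
have bound (c z : R) : (forall r, `|z| + c * r <= `|z + r|) -> `|c| <= 1.
  move=> h; rewrite ler_norml; have := h 1; have := h (-1).
  have := ler_normD z 1; have := ler_normD z (-1); rewrite normrN normr1.
  lra.
have exact_ (c z : R) : (forall r, `|z| + c * r <= `|z + r|) -> c * z = `|z|.
  move=> h; have := h (- z); rewrite subrr normr0.
  have := ler_norm (c * z); rewrite normrM.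
  have := ler_wpM2r (normr_ge0 z) (bound _ _ h); lra.
have a1 := bound _ _ hs.
have ax := exact_ _ _ hs; have by_ := exact_ _ _ ht.
have ay : a * y <= `|y|.
  apply: le_trans (ler_norm _) _; rewrite normrM.
  by have := ler_wpM2r (normr_ge0 y) a1; lra.
have axy : a * (x - y) <= `|x - y|.
  apply: le_trans (ler_norm _) _; rewrite normrM.
  by have := ler_wpM2r (normr_ge0 (x - y)) a1; lra.
have yx : `|y| - `|x| <= `|x - y| by rewrite distrC; exact: lerB_dist.
rewrite -normrM ler0_norm; nra.
Qed.

End L1Subdifferential.

Lemma ge0_of_quadratic_perturbation {R : realFieldType} (a b : R) :
  (forall t, 0 < t <= 1 -> 0 <= t * a + t ^+ 2 * b) -> 0 <= a.
Proof.
move=> h; rewrite leNgt; apply/negP => a0.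
have D : 0 < `|b| - a + 1 by have := normr_ge0 b; lra.
(* This replaces the limit at 0: for [a < 0] this [t] lies in [(0, 1]] and makes [a + t * b]
   negative. *)
pose t := - a / (`|b| - a + 1).
have t0 : 0 < t by rewrite divr_gt0 ?oppr_gt0.
have t1 : t <= 1 by rewrite ler_pdivrMr // mul1r; have := normr_ge0 b; lra.
have tD : t * (`|b| - a + 1) = - a by rewrite mulfVK // gt_eqF.
have := h t; rewrite t0 t1 => /(_ isT).
rewrite expr2 -mulrA -mulrDr pmulr_rge0 // => h1.
have := ler_norm b; have := normr_ge0 b; nra.
Qed.

(** * Stationarity of Lagrangian minimizers and global bounds on the multipliers *)

Section KKT.
Context {R : realType} {n : nat}.
Variables (Sigma : 'M[R]_n) (lambda : R) (mu : 'cV[R]_n) (rho : R).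
Hypotheses (Sigma_sym : Sigma^T = Sigma) (lambda_ge0 : 0 <= lambda).

(** On the segment from [u] to [v] the quadratic part expands exactly and convexity bounds the l1
    part, so the coefficient of [t] must be nonnegative. *)
Lemma lagrangian_first_order (u : 'cV[R]_n) (p : 'cV[R]_2) :
  (forall v, mlp_lagrangian Sigma lambda mu rho u p <=
             mlp_lagrangian Sigma lambda mu rho v p) ->
  forall v, 0 <= dotp (Sigma *m u + p 0 0 *: mu + p 1 0 *: ones n) (v - u)
                 + lambda * (l1norm v - l1norm u).
Proof.
move=> umin v; set g := _ + _ + _.
apply: (@ge0_of_quadratic_perturbation _ _
  (2^-1 * dotp (v - u) (Sigma *m (v - u)))) => t /andP[t0 t1].
have l1_convex : l1norm (u + t *: (v - u)) <= l1norm u + t * (l1norm v - l1norm u).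
  rewrite /l1norm mulrBr !mulr_sumr -sumrB -big_split; apply: ler_sum => i _ /=.
  rewrite !mxE.
  have -> : u i 0 + t * (v i 0 - u i 0) = (1 - t) * u i 0 + t * v i 0 by ring.
  apply: le_trans (ler_normD _ _) _; rewrite !normrM (gtr0_norm t0) ger0_norm; lra.
have := umin (u + t *: (v - u)).
have := ler_wpM2l lambda_ge0 l1_convex.
rewrite /mlp_lagrangian /mlp_objective /g mulmxDr -scalemxAr.
move: (v - u) => e; rewrite !dotpDl !dotpDr !dotpZl !dotpZr.
rewrite (dotp_mulmx_sym Sigma u e Sigma_sym) (dotpC (Sigma *m u)).
lra.
Qed.

Lemma lagrangian_min_kkt (u : 'cV[R]_n) (p : 'cV[R]_2) :
  (forall v, mlp_lagrangian Sigma lambda mu rho u p <=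
             mlp_lagrangian Sigma lambda mu rho v p) ->
  exists2 s, subdifferential (@l1norm R n) u s &
    Sigma *m u + lambda *: s + p 0 0 *: mu + p 1 0 *: ones n = 0.
Proof.
move=> /lagrangian_first_order; set g := _ + _ + _ => fo.
have gE s : Sigma *m u + lambda *: s + p 0 0 *: mu + p 1 0 *: ones n =
    g + lambda *: s.
  by rewrite /g -!addrA; congr (_ + _); rewrite addrC -addrA.
(* For [lambda = 0] any subgradient serves, and testing with [v = u - g] forces [g = 0]. *)
have [l0|l0] := eqVneq lambda 0.
  exists (map_mx Num.sg u); first exact: subdifferential_l1norm_sgr.
  rewrite gE l0 scale0r addr0; apply/dotp_eq0/eqP.
  rewrite eq_le dotp_ge0 andbT.
  have := fo (u - g); rewrite l0 mul0r addr0 addrAC subrr add0r dotpNr; lra.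
(* The equation dictates this witness; its subgradient inequality is the first-order condition
   divided by [lambda]. *)
exists (- lambda^-1 *: g); last first.
  by rewrite gE scalerA mulrN divff // scaleN1r subrr.
move=> v; have lp : 0 < lambda by rewrite lt_def l0.
rewrite dotpZl -subr_ge0 -(pmulr_rge0 _ lp).
have -> : lambda * (l1norm v - (l1norm u + - lambda^-1 * dotp g (v - u))) =
    dotp g (v - u) + lambda * (l1norm v - l1norm u) by field.
exact: fo.
Qed.

(** Here [v], [t] and [d] stand for the optimal point, its subgradient and the multiplier error; [C]
    is uniform in [u], [s] and [d]. *)
Lemma multiplier_row_bound (v t : 'cV[R]_n) (i : 'I_n) :
  subdifferential (@l1norm R n) v t -> v i 0 != 0 ->
  exists2 C : R, 0 <= C & forall u s (d : 'cV[R]_2),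
    subdifferential (@l1norm R n) u s ->
    `|d 0 0 * mu i 0 + d 1 0| <=
      C * (l2norm (u - v) + l2norm (Sigma *m (u - v) + lambda *: (s - t)
                                    + d 0 0 *: mu + d 1 0 *: ones n)).
Proof.
move=> tv vi0; have vi_gt0 : 0 < `|v i 0| by rewrite normr_gt0.
set r := l2norm (row i Sigma)^T; have r0 : 0 <= r by exact: l2norm_ge0.
pose q := lambda * (2 / `|v i 0|).
have q0 : 0 <= q by rewrite mulr_ge0 ?divr_ge0 // ltW.
(* The summands pay for the residual entry, the subgradient change and row [i] of [Sigma],
   respectively. *)
exists (1 + q + r) => [|u s d su]; first by rewrite !addr_ge0.
set y := _ + _ + _ + _; set e := u - v.
have dE : d 0 0 * mu i 0 + d 1 0 =
    y i 0 - (Sigma *m e) i 0 - lambda * (s i 0 - t i 0).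
  by rewrite /y !mxE; ring.
have st : `|lambda * (s i 0 - t i 0)| <= q * `|e i 0|.
  rewrite normrM (ger0_norm lambda_ge0) /q -mulrA ler_wpM2l //.
  rewrite mulrAC ler_pdivlMr //.
  by have := subdifferential_l1norm_coord_lip _ _ _ _ i su tv; rewrite /e !mxE.
have yi := coord_le_l2norm y i; have ei := coord_le_l2norm e i.
have Si := mulmx_coord_bound Sigma e i.
have Y0 := l2norm_ge0 y; have E0 := l2norm_ge0 e.
have qe : q * `|e i 0| <= q * l2norm e by rewrite ler_wpM2l.
rewrite dE; apply: le_trans (ler_normB _ _) _.
apply: le_trans (lerD (ler_normB _ _) (lexx _)) _.
rewrite -/r in Si; have qY := mulr_ge0 q0 Y0; have rY := mulr_ge0 r0 Y0.
lra.
Qed.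

Lemma multiplier_bound (v t : 'cV[R]_n) (i j : 'I_n) :
  subdifferential (@l1norm R n) v t ->
  v i 0 != 0 -> v j 0 != 0 -> mu i 0 != mu j 0 ->
  exists2 C : R, 0 <= C & forall u s (d : 'cV[R]_2),
    subdifferential (@l1norm R n) u s ->
    `|d 0 0| + `|d 1 0| <=
      C * (l2norm (u - v) + l2norm (Sigma *m (u - v) + lambda *: (s - t)
                                    + d 0 0 *: mu + d 1 0 *: ones n)).
Proof.
move=> tv vi vj mij.
have [Ci Ci0 hi] := multiplier_row_bound _ _ _ tv vi.
have [Cj Cj0 hj] := multiplier_row_bound _ _ _ tv vj.
have mij0 : 0 < `|mu i 0 - mu j 0| by rewrite normr_gt0 subr_eq0.
(* Subtracting the two rows eliminates [d 1 0], so [D] bounds [d 0 0]; row [i] then bounds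
   [d 1 0]. *)
pose D := (Ci + Cj) / `|mu i 0 - mu j 0|.
have D0 : 0 <= D by rewrite divr_ge0 ?addr_ge0.
exists (D + (Ci + D * `|mu i 0|)) => [|u s d su].
  by have := mulr_ge0 D0 (normr_ge0 (mu i 0)); lra.
have {hi} := hi u s d su; have {hj} := hj u s d su.
set Z := _ + l2norm _ => hj hi.
have d0 : `|d 0 0| <= D * Z.
  rewrite /D mulrAC ler_pdivlMr // -normrM.
  have -> : d 0 0 * (mu i 0 - mu j 0) =
      (d 0 0 * mu i 0 + d 1 0) - (d 0 0 * mu j 0 + d 1 0) by ring.
  by apply: le_trans (ler_normB _ _) _; rewrite mulrDl lerD.
have d1 : `|d 1 0| <= Ci * Z + D * Z * `|mu i 0|.
  have -> : d 1 0 = (d 0 0 * mu i 0 + d 1 0) - d 0 0 * mu i 0 by ring.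
  apply: le_trans (ler_normB _ _) _; rewrite normrM.
  by apply: lerD => //; apply: ler_wpM2r.
by apply: le_trans (lerD d0 d1) _; lra.
Qed.

End KKT.

(** * Passage to the set distance, the scalar estimate and the final assembly *)

Lemma le_mul_set_dist {R : realType} {n : nat} (c r : R) (y : 'cV[R]_n)
    (A : set 'cV[R]_n) :
  0 < c -> (forall z, A z -> r <= c * l2norm (y - z)) ->
  (r%:E <= c%:E * set_dist y A)%E.
Proof.
move=> c0 h; rewrite -lee_pdivrMl //; apply: le_ereal_inf_tmp => _ [z Az <-].
by rewrite -EFinM lee_fin ler_pdivrMl //; apply: h.
Qed.

(** Meant for [E], [Y], [Z] the sizes of the primal error, the residual and the multiplier error. If
    [E > Y], then [Z <= 2 * C * E], and a factor [E] cancels. *)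
Lemma le_of_sqr_le_mixed {R : realFieldType} (T C E Y Z : R) :
  0 <= T -> 0 <= C -> 0 <= E -> 0 <= Y -> Z <= C * (E + Y) ->
  E ^+ 2 <= T * (E * Y + Z * Y) -> E <= (1 + T * (1 + 2 * C)) * Y.
Proof.
move=> T0 C0 E0 Y0 ZC hE.
have K0 : 0 <= T * (1 + 2 * C) by rewrite mulr_ge0 ?addr_ge0 ?mulr_ge0.
have [EY|YE] := leP E Y; first by rewrite mulrDl mul1r; have := mulr_ge0 K0 Y0; lra.
have Ep : 0 < E by apply: le_lt_trans YE.
rewrite mulrDl mul1r -(ler_pM2l Ep) -expr2; apply: le_trans hE _.
have Z2 : Z <= 2 * C * E by have := ler_wpM2l C0 (ltW YE); lra.
have : T * (E * Y + Z * Y) <= T * (E * Y + 2 * C * E * Y).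
  by rewrite ler_wpM2l // lerD2l ler_wpM2r.
have := mulr_ge0 E0 Y0; lra.
Qed.

Theorem proposition2 (R : realType) (n : nat)
    (Sigma : 'M[R]_n) (lambda : R) (mu : 'cV[R]_n) (rho : R)
    (Sigma_posdef : sym_posdef Sigma) (lambda_ge0 : 0 <= lambda)
    (ustar : 'cV[R]_n) (pstar : 'cV[R]_2)
    (ustar_opt : mlp_optimal Sigma lambda mu rho ustar)
    (ustar_supp : exists i j : 'I_n,
       [/\ ustar i 0 != 0, ustar j 0 != 0 & mu i 0 != mu j 0])
    (wstar_saddle : mlp_saddle_point Sigma lambda mu rho ustar pstar) :
  global_strong_metric_subregular (mlp_kkt Sigma lambda mu rho)
    (col_mx ustar pstar) 0.
Proof.
have [[mu_ustar ones_ustar] _] := ustar_opt.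
have [sstar dsstar kkt0] :=
  lagrangian_min_kkt _ _ _ _ Sigma_posdef.1 lambda_ge0 _ _
    wstar_saddle.2.
have [i [j [ui uj mij]]] := ustar_supp.
have [T T0 coercive] := posdef_coercive _ Sigma_posdef.
have [C C0 multipliers] :=
  multiplier_bound Sigma lambda mu lambda_ge0 _ _ _ _ dsstar ui uj mij.
split.
  exists sstar; rewrite col_mxKu ?col_mxKd // kkt0 mu_ustar ones_ustar !subrr.
  by rewrite !raddf0 !col_mx0.
pose K := 1 + T * (1 + 2 * C).
have K0 : 0 <= K by rewrite /K addr_ge0 ?mulr_ge0 ?addr_ge0 ?mulr_ge0.
have CK0 : 0 <= C * (K + 1) by rewrite mulr_ge0 // addr_ge0.
(* [K] bounds the primal error and [C * (K + 1)] the multiplier error; the added 1 makes positivity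
   immediate. *)
exists (1 + K + C * (K + 1)) => [|w]; first lra.
apply: le_mul_set_dist => [|_ [s ds <-]]; first lra.
rewrite sub0r l2normN; move: ds; rewrite -[w]vsubmxK col_mxKu col_mxKd.
move: (usubmx w) (dsubmx w) => u p ds.
(* Subtracting the vanishing residual at the saddle point expresses everything through
   differences. *)
have -> : Sigma *m u + lambda *: s + p 0 0 *: mu + p 1 0 *: ones n =
    Sigma *m (u - ustar) + lambda *: (s - sstar)
    + (p - pstar) 0 0 *: mu + (p - pstar) 1 0 *: ones n.
  rewrite -[LHS]subr0 -kkt0 mulmxBr scalerBr !mxE.
  by apply/matrixP => a b; rewrite !mxE; ring.
have -> : dotp mu u - rho = dotp mu (u - ustar).
  by rewrite dotpDr dotpNr mu_ustar.
have -> : dotp (ones n) u - 1 = dotp (ones n) (u - ustar).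
  by rewrite dotpDr dotpNr ones_ustar.
have mult := multipliers u s (p - pstar) ds.
have mono := subdifferential_l1norm_monotone _ _ _ _ ds dsstar.
have coer := coercive (u - ustar).
rewrite opp_col_mx add_col_mx.
move: mult mono coer; set e := u - ustar; set d := p - pstar.
set y1 := Sigma *m e + _ + _ + _; set y := col_mx y1 _ => mult mono coer.
have yE : l2norm y ^+ 2 =
    l2norm y1 ^+ 2 + (dotp mu e ^+ 2 + dotp (ones n) e ^+ 2).
  rewrite /y !sqr_l2norm_col_mx !sqr_l2norm.
  by rewrite !dotpE !big_ord1 !mxE !mulr1n -!expr2.
have Y0 := l2norm_ge0 y; have E0 := l2norm_ge0 e; have Y10 := l2norm_ge0 y1.
have le_Y r : r ^+ 2 <= l2norm y ^+ 2 -> `|r| <= l2norm y.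
  by move=> h; rewrite -ler_sqr ?nnegrE // real_normK ?num_real.
have := sqr_ge0 (l2norm y1); have := sqr_ge0 (dotp mu e).
have := sqr_ge0 (dotp (ones n) e) => sq1 sqmu sqy1.
have Ymu : `|dotp mu e| <= l2norm y by apply: le_Y; rewrite yE; lra.
have Y1 : `|dotp (ones n) e| <= l2norm y by apply: le_Y; rewrite yE; lra.
have Yy1 : l2norm y1 <= l2norm y.
  by rewrite -[leLHS]ger0_norm //; apply: le_Y; rewrite yE; lra.
(* In [dotp e y1] the subgradient term is nonnegative by monotonicity, and the multipliers meet only
   [dotp mu e] and [dotp (ones n) e], which are entries of [y]. *)
have energy : dotp e (Sigma *m e) <=
    l2norm e * l2norm y + (`|d 0 0| + `|d 1 0|) * l2norm y.
  have ey1 : dotp e y1 = dotp e (Sigma *m e) + lambda * dotp e (s - sstar)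
      + d 0 0 * dotp mu e + d 1 0 * dotp (ones n) e.
    by rewrite /y1 !dotpDr !dotpZr !(dotpC e mu) !(dotpC e (ones n)) !dotpDr.
  have h1 : dotp e y1 <= l2norm e * l2norm y.
    apply: le_trans (ler_norm _) (le_trans (cauchy_schwarz _ _) _).
    by rewrite ler_wpM2l.
  have h2 a b : `|b| <= l2norm y -> - (a * b) <= `|a| * l2norm y.
    move=> hb; apply: le_trans (ler_norm _) _.
    by rewrite normrN normrM ler_wpM2l.
  have := mulr_ge0 lambda_ge0 mono.
  have := h2 (d 0 0) _ Ymu; have := h2 (d 1 0) _ Y1; lra.
have EK : l2norm e <= K * l2norm y.
  apply: (@le_of_sqr_le_mixed _ _ _ _ _ (`|d 0 0| + `|d 1 0|)) => //.
    by apply: le_trans mult _; rewrite ler_wpM2l // lerD2l.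
  by apply: le_trans coer _; rewrite ler_wpM2l.
have dK : `|d 0 0| + `|d 1 0| <= C * (K + 1) * l2norm y.
  apply: le_trans mult _; rewrite -mulrA ler_wpM2l // mulrDl mul1r.
  exact: lerD.
have wE : l2norm (col_mx e d) <= l2norm e + l2norm d.
  have D0 := l2norm_ge0 d.
  rewrite -ler_sqr ?nnegrE ?l2norm_ge0 ?addr_ge0 // sqr_l2norm_col_mx.
  by have := mulr_ge0 E0 D0; nra.
have := l2norm_cV2_le _ d; lra.
Qed.
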